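(* Let $y_t=\langle X_t,\Theta^*\rangle+\eta_t$, $t=1,\dots,T$, be the rewards in a low-rank linear bandit and let $\hat y_t$ be the predictions of the exponentially weighted average forecaster (under squared loss) whose experts are the elements of a $\frac1T$-net of $S_r$, with parameter $\eta=\frac1{2\left(2+\sqrt{2\log(2T/\delta)}\right)^2}$. Then, for any $0<\delta<0.25$, with probability at least $1-\delta$, $$\sup_{\|\Theta\|_F\le1,\ \mathrm{rank}(\Theta)\le r}\rho_T(\Theta)=\widetilde O\left((d_1+d_2)\,r\log\left(\frac1\delta\right)\right).$$
   Context: $\langle A,B\rangle=\mathrm{trace}(A^TB)$, $\|\cdot\|_F$ is the Frobenius norm. $\Theta^*\in\mathbb{R}^{d_1\times d_2}$ has rank $r$ and $\|\Theta^*\|_F\le1$; the arms $X_t\in\mathbb{R}^{d_1\times d_2}$ satisfy $\|X_t\|_F\le1$ and may be chosen based on the past; $\eta_t$ is zero-mean $1$-sub-Gaussian noise. $\widetilde O$ hides absolute constants and poly-logarithmic factors of $d_1,d_2,r,T$. $S_r=\{\Theta\in\mathbb{R}^{d_1\times d_2}:\|\Theta\|_F\le1,\ \mathrm{rank}(\Theta)\le r\}$, and $\{\Theta_1,\dots,\Theta_N\}\subset S_r$ is a $\frac1T$-net of $S_r$ in Frobenius norm (every $\Theta\in S_r$ is within $\frac1T$ of some $\Theta_i$) with $N\le(9T)^{(d_1+d_2+1)r}$. Forecaster: $\hat y_t=\frac{\sum_{i=1}^Ne^{-\eta L_{i,t-1}}\langle\Theta_i,X_t\rangle}{\sum_{j=1}^Ne^{-\eta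 L_{j,t-1}}}$, where $L_{i,t}=\sum_{s=1}^t(y_s-\langle\Theta_i,X_s\rangle)^2$, $L_{i,0}=0$ (here $\eta$ without subscript is the tuning parameter). Regret of the forecaster against $\Theta$: $\rho_T(\Theta)=\sum_{t=1}^T\left[(y_t-\hat y_t)^2-(y_t-\langle\Theta,X_t\rangle)^2\right]$. *)

(* Defs.v *)
From HB Require Import structures.
From mathcomp Require Import all_boot all_order all_algebra.
From mathcomp Require Import all_classical all_reals all_analysis.

Set Implicit Arguments.
Unset Strict Implicit.
Unset Printing Implicit Defensive.
Import Order.TTheory GRing.Theory Num.Theory.
Local Open Scope classical_set_scope.
Local Open Scope ring_scope.

Definition inner (R : realType) (d1 d2 : nat) (A B : 'M[R]_(d1, d2)) : R :=
  \tr (A^T *m B).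

(* The library norm on matrices is the max norm, hence this definition. *)
Definition frob (R : realType) (d1 d2 : nat) (A : 'M[R]_(d1, d2)) : R :=
  Num.sqrt (inner A A).

Definition low_rank_ball (R : realType) (d1 d2 r : nat) : set 'M[R]_(d1, d2) :=
  [set Theta | frob Theta <= 1 /\ (\rank Theta <= r)%N].
Arguments low_rank_ball : clear implicits.

Definition is_net (R : realType) (d1 d2 N : nat) (S : set 'M[R]_(d1, d2))
    (eps : R) (Theta : 'I_N -> 'M[R]_(d1, d2)) : Prop :=
  (forall i, S (Theta i)) /\
  (forall A, S A -> exists i, frob (A - Theta i) <= eps).

(* Rounds are numbered 1, 2, ...; the value at 0 of a sequence indexed by
   rounds is never used.  The definitions below are deterministic: they are
   applied to one realization of the arms x and of the rewards y. *)
Definition cum_loss (R : realType) (d1 d2 : nat) (x : nat -> 'M[R]_(d1, d2))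
    (y : nat -> R) (Theta : 'M[R]_(d1, d2)) (t : nat) : R :=
  \sum_(1 <= s < t.+1) (y s - inner Theta (x s)) ^+ 2.

Definition forecast (R : realType) (d1 d2 N : nat) (eta : R)
    (Theta : 'I_N -> 'M[R]_(d1, d2)) (x : nat -> 'M[R]_(d1, d2))
    (y : nat -> R) (t : nat) : R :=
  (\sum_(i < N) expR (- eta * cum_loss x y (Theta i) t.-1)
                * inner (Theta i) (x t))
  / (\sum_(j < N) expR (- eta * cum_loss x y (Theta j) t.-1)).

Definition regret (R : realType) (d1 d2 : nat) (x : nat -> 'M[R]_(d1, d2))
    (y yhat : nat -> R) (T : nat) (Theta : 'M[R]_(d1, d2)) : R :=
  \sum_(1 <= t < T.+1)
    ((y t - yhat t) ^+ 2 - (y t - inner Theta (x t)) ^+ 2).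

Definition filtration (d : measure_display) (Omega : measurableType d)
    (F : nat -> set (set Omega)) : Prop :=
  [/\ forall t, sigma_algebra setT (F t),
      forall t, F t `<=` measurable
    & forall s t, (s <= t)%N -> F s `<=` F t].

Definition measurable_wrt (R : realType) (Omega : Type) (G : set (set Omega))
    (f : Omega -> R) : Prop :=
  preimage_set_system setT f measurable `<=` G.

Definition measurable_mx_wrt (R : realType) (d1 d2 : nat) (Omega : Type)
    (G : set (set Omega)) (X : Omega -> 'M[R]_(d1, d2)) : Prop :=
  forall i j, measurable_wrt G (fun w => X w i j).

Definition zero_mean (d : measure_display) (Omega : measurableType d)
    (R : realType) (P : probability Omega R) (f : Omega -> R) : Prop :=
  P.-integrable setT (EFin \o f) /\ ('E_P[f] = 0)%E.

Definition sub_gaussian (d : measure_display) (Omega : measurableType d)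
    (R : realType) (P : probability Omega R) (sigma : R) (f : Omega -> R)
    : Prop :=
  forall l : R,
    (mmt_gen_fun P f l <= (expR (sigma ^+ 2 * l ^+ 2 / 2))%:E)%E.

(* A poly-logarithmic factor of d1, d2, r, T is one bounded by
   C * log_factor ^+ k for some constants C and k.  As [ln 0 = 0] here, the
   value is at least 1, including when some of the parameters vanish. *)
Definition log_factor (R : realType) (d1 d2 r T : nat) : R :=
  1 + ln d1%:R + ln d2%:R + ln r%:R + ln T%:R.

(* Main.v *)
Require Import Defs.
From HB Require Import structures.
From mathcomp Require Import all_boot all_order all_algebra.
From mathcomp Require Import ring lra.
From mathcomp Require Import all_classical all_reals all_analysis.
From mathcomp Require Import measurable_realfun.
Set Implicit Arguments.
Unset Strict Implicit.
Unset Printing Implicit Defensive.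
Import Order.TTheory GRing.Theory Num.Theory.
Import numFieldNormedType.Exports.
Local Open Scope classical_set_scope.
Local Open Scope ring_scope.

(* Let [b = 2 + sqrt (2 ln (2T/delta))].  By Chernoff's bound and a union
bound, all the noises are at most [b - 2] in absolute value with probability
at least [1 - delta]; every expert, and every [Theta] of the ball, then has
residuals bounded by [b].  On [[-b, b]] the map [z |-> exp (- eta z^2)] is
concave for [eta = 1 / (2 b^2)], so the exponential weights lose at most
[ln N / eta] to the best expert.  Replacing [Theta] by its neighbour in the net
costs at most [2b / T] per round.  The event is measurable because the regret
is continuous in [Theta], which reduces the supremum to countably many
matrices. *)

(** * Exponential concavity of the squared loss *)

(** The right side is the tangent at [m] to [exp (- eta z^2)], a map concave where [2 eta z^2 <= 1].
    Multiplying through by [exp (eta z^2)] leaves a function whose monotonicity follows from its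
    first derivative. *)
Lemma exp_square_tangent (R : realType) (eta b z m : R) :
  0 <= eta -> 2 * eta * b ^+ 2 <= 1 -> `|z| <= b -> `|m| <= b ->
  expR (- eta * z ^+ 2) <=
    expR (- eta * m ^+ 2) * (1 - 2 * eta * m * (z - m)).
Proof.
move=> eta0 etab zb mb.
(* The claim is [1 <= f z]; [f m = 1], and [f'] has the sign of [a - m] on
   [[-b, b]]. *)
pose f (a : R) := (1 - 2 * eta * m * (a - m)) * expR (eta * (a ^+ 2 - m ^+ 2)).
pose df (x : R) :=
  expR (eta * (x ^+ 2 - m ^+ 2)) * (2 * eta * (x - m) * (1 - 2 * eta * m * x)).
have fE (x : R) : is_derive x 1 f (df x).
  have h1 : is_derive x 1 (fun a : R => eta * (a ^+ 2 - m ^+ 2)) (2 * eta * x).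
    by apply: is_derive_eq; rewrite /= /GRing.scale /=; ring.
  have h2 := @is_derive1_comp R expR _ x _ _ (is_derive_expR _) h1.
  have h3 : is_derive x 1 (fun a : R => 1 - 2 * eta * m * (a - m))
              (- (2 * eta * m)).
    by apply: is_derive_eq; rewrite /= /GRing.scale /=; ring.
  have h4 := is_deriveM h3 h2.
  by apply: is_derive_eq; rewrite /= /df /GRing.scale /=; ring.
have fcont (u v : R) : {within `[u, v], continuous f}.
  by apply: derivable_within_continuous => x _; case: (fE x).
have fm : f m = 1 by rewrite /f !subrr !mulr0 expR0 subr0 mulr1.
have dfs (x : R) : `|x| <= b -> exists2 k, 0 <= k & df x = k * (x - m).
  move=> xb.
  exists (expR (eta * (x ^+ 2 - m ^+ 2)) * (2 * eta) * (1 - 2 * eta * m * x)).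
    rewrite mulr_ge0 ?mulr_ge0 ?expR_ge0// subr_ge0.
    apply: le_trans etab; rewrite -!mulrA ler_wpM2l// ler_wpM2l//.
    rewrite (le_trans (ler_norm _))// normrM expr2.
    by apply: ler_pM.
  by rewrite /df; ring.
have f1 : 1 <= f z.
  rewrite -fm.
  have bnd (x u v : R) : `|u| <= b -> `|v| <= b -> x \in `[u, v] -> `|x| <= b.
    rewrite in_itv/= !ler_norml => /andP[? ?] /andP[? ?] /andP[? ?].
    by apply/andP; split; lra.
  case: (leP m z) => mz.
    have [c cmz fc] := MVT_segment mz (fun x _ => fE x) (@fcont m z).
    have [k k0 dk] := dfs c (bnd _ _ _ mb zb cmz).
    rewrite -subr_ge0 fc dk; move: cmz; rewrite in_itv/= => /andP[mc cz].
    by rewrite !mulr_ge0// subr_ge0.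
  have [c cmz fc] := MVT_segment (ltW mz) (fun x _ => fE x) (@fcont z m).
  have [k k0 dk] := dfs c (bnd _ _ _ zb mb cmz).
  rewrite -subr_le0 fc dk; move: cmz; rewrite in_itv/= => /andP[mc cz].
  by rewrite mulr_le0_ge0 ?mulr_ge0_le0 ?subr_le0 ?subr_ge0// ltW.
rewrite -[leLHS]mulr1; apply: le_trans (ler_wpM2l (expR_ge0 _) f1) _.
rewrite /f mulrCA -expRD mulrC.
suff -> : - eta * z ^+ 2 + eta * (z ^+ 2 - m ^+ 2) = - eta * m ^+ 2 by [].
by ring.
Qed.

(** Average the tangent inequalities taken at the weighted mean [m]: the linear terms cancel because
    [\sum_i w i * (z i - m) = 0]. *)
Lemma exp_square_jensen (R : realType) (I : finType) (eta b : R)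
    (w z : I -> R) :
  0 <= eta -> 2 * eta * b ^+ 2 <= 1 ->
  (forall i, 0 <= w i) -> (forall i, `|z i| <= b) -> 0 < \sum_i w i ->
  \sum_i w i * expR (- eta * z i ^+ 2) <=
    (\sum_i w i) * expR (- eta * ((\sum_i w i * z i) / \sum_i w i) ^+ 2).
Proof.
move=> eta0 etab w0 zb W0; set W := \sum_i w i; set m := _ / W.
have mb : `|m| <= b.
  rewrite normrM normfV (ger0_norm (ltW W0)) ler_pdivrMr// mulr_sumr.
  apply: (le_trans (ler_norm_sum _ _ _)); apply: ler_sum => i _.
  by rewrite normrM (ger0_norm (w0 i)) mulrC ler_wpM2r.
have -> : W * expR (- eta * m ^+ 2) =
    \sum_i w i * (expR (- eta * m ^+ 2) * (1 - 2 * eta * m * (z i - m))).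
  have -> : \sum_i w i * (expR (- eta * m ^+ 2) * (1 - 2 * eta * m * (z i - m)))
      = \sum_i (w i * (expR (- eta * m ^+ 2) * (1 + 2 * eta * m * m))
          - (w i * z i) * (expR (- eta * m ^+ 2) * (2 * eta * m))).
    by apply: eq_bigr => i _; ring.
  rewrite sumrB -!mulr_suml -/W.
  have -> : \sum_i w i * z i = W * m by rewrite /m mulrCA divff ?mulr1// gt_eqF.
  by ring.
apply: ler_sum => i _; rewrite ler_wpM2l//.
exact: exp_square_tangent (zb i) mb.
Qed.

(** * Trace inner product and Frobenius norm *)

Lemma innerE (R : realType) (d1 d2 : nat) (A B : 'M[R]_(d1, d2)) :
  inner A B = \sum_j \sum_i A i j * B i j.
Proof.
rewrite /inner /mxtrace; apply: eq_bigr => j _; rewrite mxE.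
by apply: eq_bigr => i _; rewrite mxE.
Qed.

Lemma innerC (R : realType) (d1 d2 : nat) (A B : 'M[R]_(d1, d2)) :
  inner A B = inner B A.
Proof.
by rewrite !innerE; do 2 (apply: eq_bigr => ? _); rewrite mulrC.
Qed.

Lemma innerBl (R : realType) (d1 d2 : nat) (A B C : 'M[R]_(d1, d2)) :
  inner (A - B) C = inner A C - inner B C.
Proof. by rewrite /inner linearB mulmxBl linearB. Qed.

Lemma innerZl (R : realType) (d1 d2 : nat) (a : R) (A B : 'M[R]_(d1, d2)) :
  inner (a *: A) B = a * inner A B.
Proof. by rewrite /inner linearZ -scalemxAl linearZ. Qed.

Lemma inner_ge0 (R : realType) (d1 d2 : nat) (A : 'M[R]_(d1, d2)) :
  0 <= inner A A.
Proof.
by rewrite innerE; do 2 (apply: sumr_ge0 => ? _); rewrite -expr2 sqr_ge0.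
Qed.

(** Cauchy-Schwarz: expand [0 <= |A - u B|^2 = |A|^2 - 2 u^2 + u^2 |B|^2] with [u = <A, B>], and use
    [|B| <= 1]. *)
Lemma inner_frob_le (R : realType) (d1 d2 : nat) (A B : 'M[R]_(d1, d2)) :
  frob B <= 1 -> `|inner A B| <= frob A.
Proof.
move=> B1; have BB1 : inner B B <= 1.
  by rewrite -(sqr_sqrtr (inner_ge0 B)) expr_le1// sqrtr_ge0.
have := inner_ge0 (A - inner A B *: B).
rewrite innerBl innerZl !(innerC _ (A - _)) !innerBl !innerZl (innerC B A).
set u := inner A B => h.
rewrite -sqrtr_sqr /frob ler_sqrt ?inner_ge0//.
have : u ^+ 2 * inner B B <= u ^+ 2 by rewrite ler_piMr// sqr_ge0.
by nra.
Qed.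

(** * Deterministic regret bounds *)

(** The total weight starts at [N]. The forecaster's residual is the weighted mean of the experts'
    residuals, so by Jensen each round multiplies the total by at most
    [exp (- eta (y t - yhat t)^2)]. The final total dominates the weight of expert [i]; take
    logarithms. *)
Lemma forecast_regret (R : realType) (d1 d2 N T : nat) (eta b : R)
    (Theta : 'I_N -> 'M[R]_(d1, d2)) (x : nat -> 'M[R]_(d1, d2))
    (y : nat -> R) (i : 'I_N) :
  0 < eta -> 2 * eta * b ^+ 2 <= 1 ->
  (forall t j, (1 <= t <= T)%N -> `|y t - inner (Theta j) (x t)| <= b) ->
  regret x y (forecast eta Theta x y) T (Theta i) <= ln N%:R / eta.
Proof.
move=> eta0 etab yb.
pose yhat := forecast eta Theta x y.
pose w n (j : 'I_N) := expR (- eta * cum_loss x y (Theta j) n).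
have W0 n : 0 < \sum_j w n j.
  rewrite (bigD1 i)//= ltr_pwDl ?expR_gt0// sumr_ge0// => j _.
  exact: expR_ge0.
have potential n : (n <= T)%N ->
    \sum_j w n j <=
      N%:R * expR (- eta * \sum_(1 <= t < n.+1) (y t - yhat t) ^+ 2).
  elim: n => [|n IHn] nT.
    rewrite big_geq// mulr0 expR0 mulr1.
    under eq_bigr do rewrite /w /cum_loss big_geq// mulr0 expR0.
    by rewrite sumr_const card_ord.
  have -> : \sum_j w n.+1 j =
      \sum_j w n j * expR (- eta * (y n.+1 - inner (Theta j) (x n.+1)) ^+ 2).
    apply: eq_bigr => j _.
    by rewrite /w /cum_loss big_nat_recr//= mulrDr expRD.
  apply: (le_trans (exp_square_jensen (ltW eta0) etab _ _ (W0 n))).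
  - by move=> j; exact: expR_ge0.
  - by move=> j; exact: yb.
  have -> : (\sum_j w n j * (y n.+1 - inner (Theta j) (x n.+1)))
      / (\sum_j w n j) = y n.+1 - yhat n.+1.
    under eq_bigr do rewrite mulrBr.
    by rewrite sumrB -mulr_suml mulrBl mulrAC divff ?mul1r// gt_eqF.
  rewrite big_nat_recr//= mulrDr expRD mulrA ler_pM2r ?expR_gt0//.
  exact: IHn (ltnW nT).
have N0 : 0 < N%:R :> R by rewrite ltr0n (leq_ltn_trans _ (ltn_ord i)).
have : w T i <= \sum_j w T j.
  by rewrite (bigD1 i)//= lerDl sumr_ge0// => j _; exact: expR_ge0.
move=> /le_trans/(_ (potential T (leqnn T))).
rewrite -[in X in _ <= X -> _](lnK N0) -expRD ler_expR => h.
rewrite /regret sumrB -/yhat ler_pdivlMr//.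
by move: h; rewrite /cum_loss; lra.
Qed.

(** The forecasts cancel in each round, and the remaining difference of squares factors as
    [<A - Theta i, x t>], at most [1 / T], times a sum of two residuals, at most [2 b]. *)
Lemma regret_net (R : realType) (d1 d2 N T : nat) (b : R)
    (Theta : 'I_N -> 'M[R]_(d1, d2)) (x : nat -> 'M[R]_(d1, d2))
    (y yhat : nat -> R) (A : 'M[R]_(d1, d2)) (i : 'I_N) :
  (0 < T)%N ->
  (forall t, (1 <= t <= T)%N -> frob (x t) <= 1) ->
  frob (A - Theta i) <= 1 / T%:R ->
  (forall t, (1 <= t <= T)%N -> `|y t - inner A (x t)| <= b) ->
  (forall t, (1 <= t <= T)%N -> `|y t - inner (Theta i) (x t)| <= b) ->
  regret x y yhat T A <= regret x y yhat T (Theta i) + 2 * b.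
Proof.
move=> T0 x1 Ai yA yi.
rewrite -lerBlDl /regret -sumrB.
have -> : 2 * b = \sum_(1 <= t < T.+1) (1 / T%:R) * (2 * b).
  rewrite sumr_const_nat subn1/= -mulr_natr; field.
  by rewrite pnatr_eq0 -lt0n.
apply: ler_sum_nat => t tT.
have := x1 t tT => xt.
have hd := le_trans (inner_frob_le (A - Theta i) xt) Ai.
have -> : (y t - yhat t) ^+ 2 - (y t - inner A (x t)) ^+ 2 -
    ((y t - yhat t) ^+ 2 - (y t - inner (Theta i) (x t)) ^+ 2) =
    inner (A - Theta i) (x t) *
      ((y t - inner A (x t)) + (y t - inner (Theta i) (x t))).
  by rewrite innerBl; ring.
apply: (le_trans (ler_norm _)); rewrite normrM ler_pM//.
by rewrite mulr2n mulrDl mul1r (le_trans (ler_normD _ _))// lerD ?yA ?yi.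
Qed.

(** * Sub-Gaussian tails and the noise event *)

Lemma sub_gaussianN d (Omega : measurableType d) (R : realType)
    (P : probability Omega R) (sigma : R) (f : Omega -> R) :
  sub_gaussian P sigma f -> sub_gaussian P sigma (- f).
Proof.
move=> sf l; have := sf (- l); rewrite sqrrN.
suff -> : mmt_gen_fun P f (- l) = mmt_gen_fun P (- f) l by [].
rewrite /mmt_gen_fun; congr expectation; apply/funext => w /=.
by rewrite /= mulrN mulNr.
Qed.

Lemma sub_gaussian_upper_tail d (Omega : measurableType d) (R : realType)
    (P : probability Omega R) (sigma u : R) (f : Omega -> R) :
  0 < sigma -> 0 < u -> measurable_fun setT f -> sub_gaussian P sigma f ->
  (P [set w | (u <= f w)%R] <= (expR (- u ^+ 2 / (2 * sigma ^+ 2)))%:E)%E.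
Proof.
move=> s0 u0 mf sf.
pose X : {RV P >-> R} := mfun_Sub (mem_set mf).
(* This value of [l] minimises the Chernoff exponent [sigma ^+ 2 * l ^+ 2 / 2 - l * u]. *)
have l0 : 0 < u / sigma ^+ 2 by rewrite divr_gt0// exprn_gt0.
apply: (le_trans (chernoff X u l0)).
apply: (@le_trans _ _
  ((expR (sigma ^+ 2 * (u / sigma ^+ 2) ^+ 2 / 2))%:E
   * (expR (- (u / sigma ^+ 2 * u)))%:E)%E).
  by apply: lee_wpmul2r; [rewrite lee_fin expR_ge0 | exact: sf].
rewrite -EFinM -expRD lee_fin ler_expR le_eqVlt; apply/orP; left; apply/eqP.
by field; rewrite gt_eqF.
Qed.

Lemma sub_gaussian_tail d (Omega : measurableType d) (R : realType)
    (P : probability Omega R) (sigma u : R) (f : Omega -> R) :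
  0 < sigma -> 0 < u -> measurable_fun setT f -> sub_gaussian P sigma f ->
  (P [set w | (u <= `|f w|)%R] <=
     (2 * expR (- u ^+ 2 / (2 * sigma ^+ 2)))%:E)%E.
Proof.
move=> s0 u0 mf sf.
have mge (g : Omega -> R) : measurable_fun setT g ->
    measurable [set w | u <= g w].
  move=> mg; rewrite -[X in measurable X]setTI.
  have -> : [set w | u <= g w] = g @^-1` `[u, +oo[.
    by apply/seteqP; split => w /=; rewrite in_itv/= andbT.
  exact: mg.
have mNf : measurable_fun setT (- f) by exact: measurableT_comp.
have -> : [set w | u <= `|f w|] = [set w | u <= f w] `|` [set w | u <= (- f) w].
  by apply/seteqP; split => w /=; rewrite ler_normr => /orP.
apply: (le_trans (measureU2 _ (mge _ mf) (mge _ mNf))).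
rewrite mulr_natl mulr2n EFinD.
apply: leeD; apply: sub_gaussian_upper_tail => //.
exact: sub_gaussianN.
Qed.

(** The threshold [u] solves [2 exp (- u^2 / 2) = delta / T], so the [T] bad events have total
    probability at most [delta]. No independence is involved. *)
Lemma sub_gaussian_union_bound d (Omega : measurableType d) (R : realType)
    (P : probability Omega R) (T : nat) (delta : R) (f : nat -> Omega -> R) :
  (0 < T)%N -> 0 < delta -> delta < 1 ->
  (forall t, (1 <= t <= T)%N -> measurable_fun setT (f t)) ->
  (forall t, (1 <= t <= T)%N -> sub_gaussian P 1 (f t)) ->
  exists2 E, measurable E & ((1 - delta)%:E <= P E)%E /\
    forall w, E w -> forall t, (1 <= t <= T)%N ->
      `|f t w| <= Num.sqrt (2 * ln (2 * T%:R / delta)).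
Proof.
move=> T0 d0 d1 mf sf; set u := Num.sqrt _.
have TR : 1 <= T%:R :> R by rewrite ler1n.
have q1 : 1 < 2 * T%:R / delta by rewrite ltr_pdivlMr//; lra.
have lnq : 0 < ln (2 * T%:R / delta) by rewrite ln_gt0.
have u0 : 0 < u by rewrite sqrtr_gt0 mulr_gt0.
(* Indices [0 .. T - 1] stand for rounds [1 .. T]. *)
pose B (i : nat) := [set w | u <= `|f i.+1 w|].
have mB i : (i < T)%N -> measurable (B i).
  move=> iT; rewrite -[X in measurable X]setTI.
  have -> : B i = (Num.norm \o f i.+1) @^-1` `[u, +oo[.
    by apply/seteqP; split => w /=; rewrite /B/= in_itv/= andbT.
  apply: (measurableT_comp _ (mf i.+1 _)) => //.
have mU : measurable (\big[setU/set0]_(i < T) B i).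
  by apply: bigsetU_measurable => i _; exact: mB.
exists (~` \big[setU/set0]_(i < T) B i); first exact: measurableC.
split.
  rewrite probability_setC// EFinB leeB//.
  apply: (le_trans (Boole_inequality _ mB)).
  apply: (@le_trans _ _ (\sum_(i < T) (delta / T%:R)%:E)%E).
    apply: lee_sum => i _.
    have iT : (1 <= i.+1 <= T)%N by rewrite /= ltn_ord.
    apply: (le_trans (sub_gaussian_tail ltr01 u0 (mf _ iT) (sf _ iT))).
    rewrite lee_fin expr1n mulr1 /u sqr_sqrtr; last by rewrite mulr_ge0// ltW.
    rewrite -mulNr mulrAC mulNr divff// mulN1r expRN.
    rewrite lnK ?posrE ?(lt_trans ltr01)//.
    rewrite le_eqVlt; apply/orP; left; apply/eqP; field.
    by rewrite !gt_eqF// (lt_le_trans ltr01).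
  rewrite sumEFin lee_fin sumr_const card_ord -[leLHS]mulr_natr divfK//.
  by rewrite gt_eqF// (lt_le_trans ltr01).
move=> w; rewrite -bigcup_mkord => Ew [//|t] /= tT.
rewrite leNgt; apply/negP => uf; apply: Ew; exists t => //.
exact: ltW.
Qed.

(** * Measurability of the regret event *)

Lemma mx_rat_dense (R : realType) (d1 d2 : nat) (A : 'M[R]_(d1, d2)) (e : R) :
  0 < e ->
  exists Q : 'M[rat]_(d1, d2), ball (map_mx ratr Q : 'M[R]_(d1, d2)) e A.
Proof.
move=> e0.
have /(_ _)/cid qP (ij : 'I_d1 * 'I_d2) :
    exists q : rat, ball (ratr q : R) e (A ij.1 ij.2).
  have [q] : exists q : rat, ratr q \in `]A ij.1 ij.2 - e, A ij.1 ij.2 + e[.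
    by apply: rat_in_itvoo; rewrite ltrBlDr -addrA ltrDl addr_gt0.
  rewrite in_itv/= => /andP[q1 q2]; exists q.
  by rewrite /ball/= ltr_distl; apply/andP; split; lra.
exists (\matrix_(i, j) sval (qP (i, j))).
by split => // i j; rewrite !mxE; exact: svalP (qP (i, j)).
Qed.

(* Countably many points of S suffice: pick one point of S in each rational
   ball which meets S. *)
Lemma measurable_forall_le d (Omega : measurableType d) (R : realType)
    (d1 d2 : nat) (S : set 'M[R]_(d1, d2)) (g : Omega -> 'M[R]_(d1, d2) -> R)
    (c : R) :
  (forall A, measurable_fun setT (g ^~ A)) ->
  (forall w, continuous (g w)) ->
  measurable [set w | forall A, S A -> g w A <= c].
Proof.
move=> mg cg.
pose D (q : 'M[rat]_(d1, d2) * nat) : set 'M[R]_(d1, d2) :=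
  S `&` ball (map_mx ratr q.1 : 'M[R]_(d1, d2)) q.2.+1%:R^-1.
(* Requiring [D q] to be nonempty keeps the default value 0 of [xget] out of play. *)
pose F q := [set w | D q !=set0 /\ c < g w (xget 0 (D q))].
have mF q : measurable (F q).
  have [Dq|Dq] := pselect (D q !=set0); last first.
    suff -> : F q = set0 by [].
    by apply/seteqP; split => w //= -[].
  suff -> : F q =
      setT `&` (g ^~ (xget 0 (D q))) @^-1` `]c, +oo[ by exact: mg.
  rewrite setTI; apply/seteqP.
  by split => w /=; rewrite in_itv/= andbT => // -[].
suff -> : [set w | forall A, S A -> g w A <= c] =
    ~` \bigcup_q F q.
  by apply: measurableC; apply: countable_bigcupT_measurable.
apply/seteqP; split => w /=.
  move=> h [q _ /= [[A DA]]]; rewrite ltNge => /negP; apply; apply: h.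
  by have [] := xgetPex 0 (ex_intro _ A DA).
move=> h A SA; rewrite leNgt; apply/negP => cA.
(* A violation at [A] persists on a ball of radius [e]. With [1 / (n + 1) < e / 2], the point chosen
   in a rational ball of that radius containing [A] is within [e] of [A], hence violates the bound
   too. *)
have : \forall B \near A, c < g w B.
  exact: (cvgr_gt _ (cg w A)) cA.
move=> /nbhs_ballP[e /= e0 eA].
have e2 : 0 < e / 2 by rewrite divr_gt0.
have [n] := ltr_add_invr e2; rewrite add0r => ne.
have n0 : 0 < n.+1%:R^-1 :> R by rewrite invr_gt0.
have [Q QA] := mx_rat_dense A n0.
have [SB QB] := xgetPex 0 (ex_intro _ A (conj SA QA) : D (Q, n) !=set0).
apply: h; exists (Q, n) => //=; split; first by exists A.
apply: eA; apply: (ball_splitr (z := map_mx ratr Q : 'M[R]_(d1, d2))).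
- exact: le_ball (ltW ne) _ QA.
- exact: le_ball (ltW ne) _ QB.
Qed.

Lemma measurable_sum_nat d (Omega : measurableType d) (R : realType)
    (m n : nat) (f : nat -> Omega -> R) :
  (forall t, (m <= t < n)%N -> measurable_fun setT (f t)) ->
  measurable_fun setT (fun w => \sum_(m <= t < n) f t w).
Proof.
move=> mf.
(* Terms outside the range may be non-measurable; replacing them by zero does not change the sum. *)
pose g t := if (m <= t < n)%N then f t else cst 0.
have -> : (fun w => \sum_(m <= t < n) f t w) =
    (fun w => \sum_(m <= t < n) g t w).
  by apply/funext => w; apply: eq_big_nat => t mtn; rewrite /g mtn.
by apply: measurable_sum => t; rewrite /g; case: ifP => // /mf.
Qed.

Lemma measurable_inner d (Omega : measurableType d) (R : realType)
    (d1 d2 : nat) (A : 'M[R]_(d1, d2)) (X : Omega -> 'M[R]_(d1, d2)) :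
  (forall i j, measurable_fun setT (fun w => X w i j)) ->
  measurable_fun setT (fun w => inner A (X w)).
Proof.
move=> mX; under eq_fun do rewrite innerE.
apply: measurable_sum => j; apply: measurable_sum => i.
exact: measurable_funM.
Qed.

Lemma measurable_cum_loss d (Omega : measurableType d) (R : realType)
    (d1 d2 n : nat) (X : nat -> Omega -> 'M[R]_(d1, d2))
    (y : nat -> Omega -> R) (A : 'M[R]_(d1, d2)) :
  (forall t, (1 <= t <= n)%N ->
     forall i j, measurable_fun setT (fun w => X t w i j)) ->
  (forall t, (1 <= t <= n)%N -> measurable_fun setT (y t)) ->
  measurable_fun setT (fun w => cum_loss (X ^~ w) (y ^~ w) A n).
Proof.
move=> mX my; apply: measurable_sum_nat => t tn.
apply: measurable_funX; apply: measurable_funB; first exact: my.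
by apply: measurable_inner; exact: mX.
Qed.

(** The two ranges differ because the prediction of round [n.+1] sees the arm of that round but not
    its reward. *)
Lemma measurable_forecast d (Omega : measurableType d) (R : realType)
    (d1 d2 N n : nat) (eta : R) (Theta : 'I_N -> 'M[R]_(d1, d2))
    (X : nat -> Omega -> 'M[R]_(d1, d2)) (y : nat -> Omega -> R) :
  (forall t, (1 <= t <= n.+1)%N ->
     forall i j, measurable_fun setT (fun w => X t w i j)) ->
  (forall t, (1 <= t <= n)%N -> measurable_fun setT (y t)) ->
  measurable_fun setT
    (fun w => forecast eta Theta (X ^~ w) (y ^~ w) n.+1).
Proof.
move=> mX my.
have mL i : measurable_fun setT
    (fun w => expR (- eta * cum_loss (X ^~ w) (y ^~ w) (Theta i) n)).
  apply: measurableT_comp => //; apply: measurable_funM => //.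
  apply: measurable_cum_loss => // t /andP[t1 tn]; apply: mX.
  by rewrite t1 (leq_trans tn).
rewrite /forecast /=; apply: measurable_funM.
  apply: measurable_sum => i; apply: measurable_funM => //.
  by apply: measurable_inner; apply: mX; rewrite leqnn.
(* The inverse of a nonnegative real is its power [- 1], also at 0, and power functions are
   measurable. *)
have -> : (fun w => (\sum_(j < N)
    expR (- eta * cum_loss (X ^~ w) (y ^~ w) (Theta j) n))^-1) =
  (fun w => (\sum_(j < N)
    expR (- eta * cum_loss (X ^~ w) (y ^~ w) (Theta j) n)) `^ (- 1)).
  apply/funext => w; rewrite powR_inv1//.
  by apply: sumr_ge0 => j _; exact: expR_ge0.
apply: (measurableT_comp (f := fun u : R => u `^ (- 1))).
  exact: measurable_powR.
exact: measurable_sum.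
Qed.

Lemma measurable_regret d (Omega : measurableType d) (R : realType)
    (d1 d2 N T : nat) (eta : R) (Theta : 'I_N -> 'M[R]_(d1, d2))
    (X : nat -> Omega -> 'M[R]_(d1, d2)) (y : nat -> Omega -> R)
    (A : 'M[R]_(d1, d2)) :
  (forall t, (1 <= t <= T)%N ->
     forall i j, measurable_fun setT (fun w => X t w i j)) ->
  (forall t, (1 <= t <= T)%N -> measurable_fun setT (y t)) ->
  measurable_fun setT (fun w => regret (X ^~ w) (y ^~ w)
    (forecast eta Theta (X ^~ w) (y ^~ w)) T A).
Proof.
move=> mX my; apply: measurable_sum_nat => -[//|t] tT.
have le_T s : (1 <= s <= t.+1)%N -> (1 <= s <= T)%N.
  by move=> /andP[-> /leq_trans]; apply.
apply: measurable_funB; apply: measurable_funX; apply: measurable_funB.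
- exact: my.
- apply: measurable_forecast => s; first by move=> /le_T; exact: mX.
  by move=> /andP[s1 st]; apply/my/le_T; rewrite s1 ltnW.
- exact: my.
- by apply: measurable_inner; exact: mX.
Qed.

Lemma continuous_inner (R : realType) (d1 d2 : nat) (B : 'M[R]_(d1, d2)) :
  continuous (fun A : 'M[R]_(d1, d2) => inner A B).
Proof.
under eq_fun do rewrite innerE.
apply: continuous_big => [|j _]; first exact: add_continuous.
apply: continuous_big => [|i _]; first exact: add_continuous.
move=> A; apply: (@continuousM _ _ (fun M : 'M[R]_(d1, d2) => M i j)).
  exact: coord_continuous.
exact: cst_continuous.
Qed.

Lemma continuous_regret (R : realType) (d1 d2 T : nat)
    (x : nat -> 'M[R]_(d1, d2)) (y yhat : nat -> R) :
  continuous (regret x y yhat T).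
Proof.
apply: continuous_big => [|t _]; first exact: add_continuous.
have h : continuous (fun A : 'M[R]_(d1, d2) => y t - inner A (x t)).
  move=> A; apply: (@continuousB _ _ _ (cst (y t)) (fun A => inner A (x t))).
    exact: cst_continuous.
  exact: continuous_inner.
move=> A; apply: (@continuousB _ _ _ (cst ((y t - yhat t) ^+ 2))
  (fun A => (y t - inner A (x t)) ^+ 2)).
  exact: cst_continuous.
exact: continuousM (h A) (h A).
Qed.

Lemma measurable_wrt_fun d (Omega : measurableType d) (R : realType)
    (G : set (set Omega)) (f : Omega -> R) :
  G `<=` measurable -> measurable_wrt G f -> measurable_fun setT f.
Proof. by move=> Gm Gf _ Y mY; apply/Gm/Gf; exists Y. Qed.

(** * Rank zero and the explicit rate *)

(** For [r = 0] the target bound is 0 and cannot absorb the discretisation cost [2 b]; but then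
    every expert and comparator is the zero matrix. *)
Lemma regret_rank0 (R : realType) (d1 d2 N T : nat) (eta : R)
    (Theta : 'I_N -> 'M[R]_(d1, d2)) (x : nat -> 'M[R]_(d1, d2))
    (y : nat -> R) (A : 'M[R]_(d1, d2)) :
  (forall i, low_rank_ball R d1 d2 0 (Theta i)) -> low_rank_ball R d1 d2 0 A ->
  regret x y (forecast eta Theta x y) T A = 0.
Proof.
have inner0 (B C : 'M[R]_(d1, d2)) : low_rank_ball R d1 d2 0 B -> inner B C = 0.
  rewrite /low_rank_ball/= leqn0 mxrank_eq0 => -[_ /eqP ->].
  by rewrite /inner trmx0 mul0mx mxtrace0.
move=> Theta0 A0; apply: big1 => t _.
rewrite /forecast big1; last by move=> i _; rewrite inner0 ?mulr0.
by rewrite mul0r inner0// subrr.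
Qed.

Lemma log_factor_ge (R : realType) (d1 d2 r T : nat) :
  1 + ln T%:R <= log_factor R d1 d2 r T.
Proof.
have ln_nat_ge0 n : 0 <= ln (n%:R : R).
  by case: n => [|n]; [rewrite ln0 | rewrite ln_ge0// ler1n].
by rewrite /log_factor; have := ln_nat_ge0 d1; have := ln_nat_ge0 d2;
  have := ln_nat_ge0 r; lra.
Qed.

(** The left side is [ln N / eta + 2 b]. With [L] the log factor, [D = (d1 + d2) r] and
    [l = ln (1 / delta)], one has [ln N <= 16 D L], [b^2 <= 20 L l] and [2 b <= b^2 <= D L b^2],
    whence [660 = (2 * 16 + 1) * 20]. *)
Lemma regret_rate (R : realType) (d1 d2 r T N : nat) (delta b : R) :
  (0 < T)%N -> 0 < delta -> delta < 1 / 4 ->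
  (0 < (d1 + d2) * r)%N -> (0 < N)%N ->
  (N <= (9 * T) ^ ((d1 + d2 + 1) * r))%N ->
  b = 2 + Num.sqrt (2 * ln (2 * T%:R / delta)) ->
  ln N%:R * (2 * b ^+ 2) + 2 * b <=
    660 * log_factor R d1 d2 r T ^+ 2
      * ((d1 + d2)%:R * r%:R * ln (1 / delta)).
Proof.
move=> T0 d0 d4 D0 N0 leN bE.
have TR : 1 <= T%:R :> R by rewrite ler1n.
have lnT : 0 <= ln (T%:R : R) by rewrite ln_ge0.
have ln2 : ln (2 : R) <= 1 by have := @le_ln1Dx R 1; apply; lra.
have ln9 : ln (9 : R) <= 8.
  by rewrite (_ : 9 = 1 + 8 :> R); [apply: le_ln1Dx; lra | ring].
(* From [ln delta <= delta - 1] and [delta < 1 / 4]. Keeping [l] away from 0 lets terms without [l]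
   be absorbed into [L * l]. *)
have l0 : 3 / 4 <= ln (1 / delta).
  rewrite mul1r lnV ?posrE//.
  have := @le_ln1Dx R (delta - 1); rewrite addrCA subrr addr0 => /(_ _) h.
  by have := h ltac:(lra); lra.
have lnq : ln (2 * T%:R / delta) = ln 2 + ln T%:R + ln (1 / delta).
  by rewrite mul1r !lnM ?posrE ?invr_gt0 ?mulr_gt0//; lra.
have lnT_L := log_factor_ge R d1 d2 r T.
have lnN : ln N%:R <= (((d1 + d2 + 1) * r)%:R : R) * (ln 9 + ln T%:R).
  have -> : (((d1 + d2 + 1) * r)%:R : R) * (ln 9 + ln T%:R) =
      ln (((9 * T) ^ ((d1 + d2 + 1) * r))%:R).
    have -> : ln 9 + ln T%:R = ln ((9 * T)%:R : R).
      by rewrite natrM lnM ?posrE ?ltr0n.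
    by rewrite natrX lnXn ?ltr0n ?muln_gt0// mulr_natl.
  by rewrite ler_ln ?posrE ?ltr0n ?expn_gt0 ?muln_gt0 ?T0// ler_nat.
move: l0 lnT_L lnN lnq; set L := log_factor _ _ _ _ _; set l := ln (1 / delta).
set D : R := (d1 + d2)%:R * r%:R.
set K : R := ((d1 + d2 + 1) * r)%:R => l0 lnT_L lnN lnq.
have D1 : 1 <= D by rewrite /D -natrM ler1n.
have KD : K <= 2 * D.
  move: D0; rewrite muln_gt0 => /andP[d12 _].
  have : 1 <= (d1 + d2)%:R :> R by rewrite ler1n.
  have : 0 <= r%:R :> R by [].
  by rewrite /K /D natrM natrD; nra.
have LL1 : 1 <= L by lra.
have Ll : 3 / 4 * L <= L * l by rewrite mulrC ler_wpM2l//; lra.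
have s2 : Num.sqrt (2 * ln (2 * T%:R / delta)) ^+ 2 =
    2 * ln (2 * T%:R / delta).
  rewrite sqr_sqrtr// mulr_ge0// ln_ge0// ler_pdivlMr//; lra.
have s0 : 0 <= Num.sqrt (2 * ln (2 * T%:R / delta)) by rewrite sqrtr_ge0.
have b2 : 2 <= b by rewrite bE; lra.
(* [(2 + s)^2 <= 8 + 2 s^2] gives [b^2 <= 8 + 4 L + 4 l]; then [L <= 4/3 L l] and [l <= L l] yield
   [16 + 4]. *)
have bL : b ^+ 2 <= 20 * (L * l).
  have : b ^+ 2 <= 8 + 2 * (2 * ln (2 * T%:R / delta)).
    rewrite -s2 bE.
    by have := sqr_ge0 (Num.sqrt (2 * ln (2 * T%:R / delta)) - 2); nra.
  have : l <= L * l by rewrite ler_peMl//; lra.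
  by rewrite lnq; lra.
have lnN' : ln N%:R <= 16 * (D * L).
  apply: (le_trans lnN); apply: (@le_trans _ _ (2 * D * (8 * L))); last by lra.
  apply: ler_pM => //; last by lra.
  by rewrite addr_ge0// ln_ge0// ler1n.
have DL1 : 1 <= D * L by nra.
have bb : 2 * b <= b ^+ 2 by nra.
have step : ln N%:R * (2 * b ^+ 2) + 2 * b <= 33 * (D * L) * b ^+ 2.
  have b20 : 0 <= b ^+ 2 by rewrite sqr_ge0.
  have := ler_wpM2r b20 lnN'; have := ler_wpM2r b20 DL1; lra.
apply: (le_trans step).
have -> : 660 * L ^+ 2 * (D * l) = 33 * (D * L) * (20 * (L * l)) by ring.
by rewrite ler_wpM2l//; lra.
Qed.

(** * The high-probability bound *)

Theorem lemma2 (R : realType) :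
  exists (C : R) (k : nat), 0 < C /\
  forall (d : measure_display) (Omega : measurableType d)
    (P : probability Omega R) (d1 d2 r T : nat) (delta : R)
    (Thetastar : 'M[R]_(d1, d2))
    (F : nat -> set (set Omega))
    (X : nat -> Omega -> 'M[R]_(d1, d2))
    (noise : nat -> Omega -> R)
    (y : nat -> Omega -> R)
    (N : nat) (Theta : 'I_N -> 'M[R]_(d1, d2)),
  (0 < T)%N ->
  0 < delta -> delta < 1 / 4 ->
  \rank Thetastar = r -> frob Thetastar <= 1 ->
  filtration F ->
  (forall t, (1 <= t <= T)%N -> measurable_mx_wrt (F t.-1) (X t)) ->
  (forall t, (1 <= t <= T)%N -> forall w, frob (X t w) <= 1) ->
  (forall t, (1 <= t <= T)%N -> measurable_wrt (F t) (noise t)) ->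
  (forall t, (1 <= t <= T)%N ->
     zero_mean P (noise t) /\ sub_gaussian P 1 (noise t)) ->
  (forall t, (1 <= t <= T)%N ->
     forall w, y t w = inner (X t w) Thetastar + noise t w) ->
  is_net (low_rank_ball R d1 d2 r) (1 / T%:R) Theta ->
  (N <= (9 * T) ^ ((d1 + d2 + 1) * r))%N ->
  let eta := 1 / (2 * (2 + Num.sqrt (2 * ln (2 * T%:R / delta))) ^+ 2) in
  let rho w := regret (X ^~ w) (y ^~ w)
                 (forecast eta Theta (X ^~ w) (y ^~ w)) T in
  ((1 - delta)%:E <=
   P [set w | (ereal_sup [set (rho w A)%:E | A in low_rank_ball R d1 d2 r] <=
       (C * log_factor R d1 d2 r T ^+ k
          * ((d1 + d2)%:R * r%:R * ln (1 / delta)))%:E)%E])%E.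
Proof.
exists 660, 2%N; split => //.
move=> d Omega P d1 d2 r T delta Thetastar F X noise y N Theta T0 d0 d4 rankT
  frobT [_ Fm _] mX frobX mnoise hnoise yE [netS net] leN.
lazy zeta; set eta := 1 / (2 * _).
pose rho w := regret (X ^~ w) (y ^~ w)
  (forecast eta Theta (X ^~ w) (y ^~ w)) T.
set c := 660 * _ * _; set S := low_rank_ball R d1 d2 r.
set b := 2 + Num.sqrt (2 * ln (2 * T%:R / delta)).
have mX' t : (1 <= t <= T)%N ->
    forall i j, measurable_fun setT (fun w => X t w i j).
  by move=> tT i j; apply: measurable_wrt_fun (mX t tT i j); exact: Fm.
have mnoise' t : (1 <= t <= T)%N -> measurable_fun setT (noise t).
  by move=> tT; apply: measurable_wrt_fun (mnoise t tT); exact: Fm.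
have my t : (1 <= t <= T)%N -> measurable_fun setT (y t).
  move=> tT; have -> : y t = (fun w => inner Thetastar (X t w) + noise t w).
    by apply/funext => w; rewrite yE// innerC.
  apply: measurable_funD; last exact: mnoise'.
  by apply: measurable_inner; exact: mX'.
have -> : [set w | (ereal_sup [set (rho w A)%:E | A in S] <= c%:E)%E] =
    [set w | forall A, S A -> rho w A <= c].
  apply/seteqP; split => w /= h.
    move=> A SA; rewrite -lee_fin; apply: le_trans h.
    by apply: ereal_sup_ubound; exists A.
  by apply: ge_ereal_sup => _ [A SA <-]; rewrite lee_fin; exact: h.
have [E mE [PE EE]] : exists2 E, measurable E & ((1 - delta)%:E <= P E)%E /\
    forall w, E w -> forall t, (1 <= t <= T)%N -> `|noise t w| <= b - 2.
  have d1' : delta < 1 by lra.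
  have [E mE [PE EE]] := sub_gaussian_union_bound T0 d0 d1' mnoise'
    (fun t tT => (hnoise t tT).2).
  by exists E => //; split=> // w Ew t tT; rewrite /b addrC addKr; exact: EE.
(* Monotonicity of [P] requires the regret event to be measurable; the inclusion of [E] in it is
   then deterministic. *)
apply: (le_trans PE); apply: le_measure; rewrite ?inE//.
  apply: measurable_forall_le => [A|w]; first exact: measurable_regret.
  exact: continuous_regret.
move=> w Ew A SA.
have [r0|r0] := posnP r.
  rewrite /rho regret_rank0 /c ?r0 ?mulr0 ?mul0r ?mulr0//.
  - by move=> i; have := netS i; rewrite r0.
  - by move: SA; rewrite /S r0.
have b2 : 2 <= b by rewrite lerDl sqrtr_ge0.
(* Both inner products are at most 1 in absolute value and the noise is at most [b - 2]. *)
have yb t B : (1 <= t <= T)%N -> S B -> `|y t w - inner B (X t w)| <= b.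
  move=> tT [B1 _]; rewrite yE//.
  have h1 := le_trans (inner_frob_le (X t w) frobT) (frobX t tT w).
  have h2 := le_trans (inner_frob_le B (frobX t tT w)) B1.
  have h3 := EE w Ew t tT.
  rewrite addrAC (le_trans (ler_normD _ _))// -lerBrDr.
  rewrite (le_trans (ler_normB _ _))//; lra.
have [i Ai] := net A SA.
have b0 : 0 < b ^+ 2 by rewrite exprn_gt0//; lra.
have eta0 : 0 < eta by rewrite /eta -/b divr_gt0// mulr_gt0.
(* Equality holds: [eta] is the largest parameter the concavity argument allows on [[-b, b]]. *)
have etab : 2 * eta * b ^+ 2 <= 1.
  rewrite /eta -/b le_eqVlt; apply/orP; left; apply/eqP; field.
  by rewrite gt_eqF//; lra.
have hnet := regret_net (forecast eta Theta (X ^~ w) (y ^~ w)) T0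
  (fun t tT => frobX t tT w) Ai (fun t tT => yb t A tT SA)
  (fun t tT => yb t _ tT (netS i)).
have hexp := @forecast_regret _ _ _ _ T eta b Theta (X ^~ w) (y ^~ w) i
  eta0 etab (fun t j tT => yb t _ tT (netS j)).
apply: (le_trans hnet).
(* A matrix of rank [r > 0] has at least [r] rows, so [d1 > 0]. *)
have D0 : (0 < (d1 + d2) * r)%N.
  rewrite muln_gt0 r0 andbT addn_gt0 (leq_trans r0)// -rankT.
  exact: rank_leq_row.
have N0 : (0 < N)%N by rewrite (leq_ltn_trans _ (ltn_ord i)).
apply: le_trans (regret_rate T0 d0 d4 D0 N0 leN erefl); rewrite lerD2r.
by apply: (le_trans hexp); rewrite /eta -/b div1r invrK.
Qed.
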